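(* Let $X$ be a Hilbert space and let $Z\in B(X)$ be of generalized index zero. Then there exists a good path converging to $Z$. Furthermore, an operator $C\in B(X)$ arises as the $(-1)$th coefficient in the inverse of a good path converging to $Z$ if and only if $$\ker(C)=\operatorname{im}(Z)\quad\text{and}\quad \operatorname{im}(C)=\ker(Z).$$ Moreover, if $Z+tE(t)=Z+\sum_{k=1}^\infty t^kE_k$ is a good path, then, setting $E_0:=Z$, there exists some $n>0$ such that $$\ker(Z)\subseteq\ker(E_m)\ \text{ for all } m<n,\quad\text{and}\quad \ker(Z)\cap\ker(E_n)=0.$$
   Context: $B(X)$ is the Banach algebra of bounded linear operators on the complex Hilbert space $X$. An admissible path to $Z\in B(X)$ is a path $t\mapsto Z+tE(t)$, $t>0$, whose values are invertible for all sufficiently small $t>0$ and where $E(t)$ is analytic for sufficiently small $t$ (given by a convergent power series in $t$ with coefficients in $B(X)$), so that $Z+tE(t)=Z+\sum_{k=1}^\infty t^kE_k$ with $E_k\in B(X)$. It is a good path if for sufficiently small $t>0$ its inverse has the form $$(Z+tE(t))^{-1}=C_{-1}t^{-1}+\sum_{k=0}^\infty t^kC_k,$$ with $C_{-1},C_0,C_1,\dots\in B(X)$ and the power series convergent near $0$. The operator $C_{-1}$ is the $(-1)$th coefficient in the inverse of the good path. An operator $Z\in B(X)$ is of generalized index zero if there exists a continuous isomorphism $\ker(Z)\to\operatorname{coker}(Z)=X/\operatorname{im}(Z)$, i.e. a linear bijection that is a homeomorphism, where $\operatorname{coker}(Z)$ has the quotient topology; in particular, such a $Z$ has closed image. *)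

(* Defs.v *)
From HB Require Import structures.
From mathcomp Require Import all_boot all_order all_algebra sesquilinear.
From mathcomp Require Import generic_quotient ring_quotient complex.
From mathcomp Require Import all_classical all_reals all_analysis.

Set Implicit Arguments.
Unset Strict Implicit.
Unset Printing Implicit Defensive.

Import Order.TTheory GRing.Theory Num.Theory.
Import numFieldNormedType.Exports.

Local Open Scope classical_set_scope.
Local Open Scope complex_scope.
Local Open Scope ring_scope.

(* A complex Hilbert space: a complete normed module over [R[i]] whose norm
   comes from an inner product, linear in its first argument and
   conjugate-linear in the second. *)
HB.mixin Record NormedModule_hasInnerProduct (R : realType) (X : Type)
    & NormedModule R[i] X := {
  inner : {dot X for Num.conj_op} ;
  inner_norm : forall x : X, inner x x = `|x| ^+ 2
}.

#[short(type="hilbertType")]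
HB.structure Definition Hilbert (R : realType) :=
  {X of CompleteNormedModule R[i] X & NormedModule_hasInnerProduct R X}.

Section BoundedOperators.
Variables (R : realType) (X : hilbertType R).

Definition bounded_linear : {pred X -> X} := fun f : X -> X =>
  `[< linear f /\ exists M : R[i], forall x, `|f x| <= M * `|x| >].

Record bounded_op := BoundedOp {
  op_fun :> X -> X ;
  op_funP : op_fun \in bounded_linear }.

HB.instance Definition _ := [isSub for op_fun].
HB.instance Definition _ := [Choice of bounded_op by <:].

Lemma bounded_linear_submod_closed : submod_closed bounded_linear.
Proof.
split.
  apply/asboolP; split; first by move=> a x y /=; rewrite scaler0 addr0.
  by exists 0 => x; rewrite mul0r normr0.
move=> a f g /asboolP[fl [M fM]] /asboolP[gl [N gN]].
apply/asboolP; split.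
  move=> b x y; rewrite /= !fctE fl gl.
  rewrite !scalerDr !scalerA mulrC -!addrA; congr (_ + _).
  by rewrite addrCA.
exists (`|a| * M + N) => x.
rewrite (le_trans (ler_normD _ _))// mulrDl lerD//.
by rewrite normrZ -mulrA ler_wpM2l.
Qed.

HB.instance Definition _ := GRing.SubChoice_isSubLmodule.Build
  R[i] (X -> X : lmodType R[i]) bounded_linear bounded_op
  (GRing.submod_closed_semi bounded_linear_submod_closed).

Lemma op_fun_linear (T : bounded_op) : linear (T : X -> X).
Proof. by have /asboolP[] := op_funP T. Qed.

HB.instance Definition _ (T : bounded_op) :=
  GRing.isLinear.Build R[i] X X *:%R (T : X -> X) (op_fun_linear T).

Lemma op_one_subproof : (@idfun X) \in bounded_linear.
Proof. by apply/asboolP; split => //; exists 1 => x; rewrite mul1r. Qed.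

Lemma op_mul_subproof (S T : bounded_op) :
  (S : X -> X) \o (T : X -> X) \in bounded_linear.
Proof.
have /asboolP[_ [M SM]] := op_funP S; have /asboolP[_ [N TN]] := op_funP T.
apply/asboolP; split; first by move=> a x y; rewrite /= !linearP.
have M0 x : `|S x| <= `|M| * `|x|.
  have [->|x0] := eqVneq x 0; first by rewrite linear0 !normr0 mulr0.
  rewrite (le_trans (SM x))// ler_wpM2r// real_ler_norm//.
  have : 0 <= M * `|x| by apply: le_trans (SM x).
  by rewrite pmulr_lge0 ?normr_gt0// => /ger0_real.
by exists (`|M| * N) => x; rewrite (le_trans (M0 _))// -mulrA ler_wpM2l.
Qed.

Definition op_one := BoundedOp op_one_subproof.
Definition op_mul (S T : bounded_op) := BoundedOp (op_mul_subproof S T).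

Lemma op_eqP (S T : bounded_op) : (forall x, S x = T x) -> S = T.
Proof. by move=> ST; apply/val_inj/funext. Qed.

Lemma op_mulA : associative op_mul.
Proof. by move=> S T U; exact: op_eqP. Qed.
Lemma op_mul1l : left_id op_one op_mul.
Proof. by move=> S; exact: op_eqP. Qed.
Lemma op_mul1r : right_id op_one op_mul.
Proof. by move=> S; exact: op_eqP. Qed.
Lemma op_mulDl : left_distributive op_mul +%R.
Proof. by move=> S T U; exact: op_eqP. Qed.
Lemma op_mulDr : right_distributive op_mul +%R.
Proof. by move=> S T U; apply: op_eqP => x; exact: linearD. Qed.

HB.instance Definition _ := GRing.Zmodule_isPzRing.Build bounded_op
  op_mulA op_mul1l op_mul1r op_mulDl op_mulDr.

Definition op_norm (T : bounded_op) : R :=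
  sup [set complex.Re `|T x| | x in [set x : X | `|x| <= 1]].

Lemma normCRe (V : normedModType R[i]) (v : V) : (complex.Re `|v|)%:C = `|v|.
Proof. by rewrite RRe_real// ger0_real. Qed.

Lemma op_norm_has_sup (T : bounded_op) :
  has_sup [set complex.Re `|T x| | x in [set x : X | `|x| <= 1]].
Proof.
split; first by exists (complex.Re `|T 0|), 0 => //=; rewrite normr0.
have /asboolP[_ [M TM]] := op_funP T.
exists (complex.Re `|M|) => _ [x /= x1 <-].
rewrite -lecR normCRe.
have -> : (complex.Re `|M|)%:C = `|M| by rewrite RRe_real// ger0_real.
have [->|x0] := eqVneq x 0; first by rewrite linear0 normr0.
rewrite (le_trans (TM x))//.
have Mx0 : 0 <= M * `|x| by apply: le_trans (TM x).
have M0 : 0 <= M by move: Mx0; rewrite pmulr_lge0 ?normr_gt0.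
by rewrite ger0_norm// ler_piMr.
Qed.

Lemma op_norm_ub (T : bounded_op) x : `|T x| <= (op_norm T)%:C * `|x|.
Proof.
have [->|x0] := eqVneq x 0; first by rewrite linear0 !normr0 mulr0.
have nx0 : `|x| != 0 by rewrite normr_eq0.
rewrite -ler_pdivrMr ?normr_gt0// mulrC.
have -> : `|x|^-1 * `|T x| = `|T (`|x|^-1 *: x)|.
  by rewrite linearZ normrZ normfV normr_id.
rewrite -normCRe lecR; apply: sup_upper_bound; first exact: op_norm_has_sup.
by exists (`|x|^-1 *: x) => //=; rewrite normrZ normfV normr_id mulVf.
Qed.

Lemma op_norm_ge0 (T : bounded_op) : 0 <= op_norm T.
Proof.
apply: sup_upper_bound; first exact: op_norm_has_sup.
by exists 0; rewrite /= ?linear0 normr0.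
Qed.

Lemma op_norm_le (T : bounded_op) (M : R) :
  (forall x, `|x| <= 1 -> `|T x| <= M%:C) -> op_norm T <= M.
Proof.
move=> TM; apply: ge_sup; first by have [] := op_norm_has_sup T.
by move=> _ [x /= x1 <-]; rewrite -lecR normCRe TM.
Qed.

Lemma op_normD (S T : bounded_op) :
  (op_norm (S + T))%:C <= (op_norm S)%:C + (op_norm T)%:C :> R[i].
Proof.
rewrite -rmorphD lecR; apply: op_norm_le => x x1.
rewrite rmorphD (le_trans (ler_normD _ _))// lerD//.
  by rewrite (le_trans (op_norm_ub _ _))// ler_piMr// lecR op_norm_ge0.
by rewrite (le_trans (op_norm_ub _ _))// ler_piMr// lecR op_norm_ge0.
Qed.

Lemma op_normZ (a : R[i]) (T : bounded_op) :
  (op_norm (a *: T))%:C = `|a| * (op_norm T)%:C :> R[i].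
Proof.
have Z_le b S : (op_norm (b *: S))%:C <= `|b| * (op_norm S)%:C :> R[i].
  have bE : (complex.Re `|b|)%:C = `|b| by rewrite RRe_real// ger0_real.
  rewrite -[in leRHS]bE -rmorphM lecR; apply: op_norm_le => x x1.
  rewrite -[X in X <= _]/`|b *: S x| normrZ rmorphM/= bE.
  rewrite ler_wpM2l// (le_trans (op_norm_ub _ _))// ler_piMr// lecR.
  exact: op_norm_ge0.
apply/eqP; rewrite eq_le Z_le/=.
have [->|a0] := eqVneq a 0.
  by rewrite normr0 mul0r lecR op_norm_ge0.
rewrite -ler_pdivlMl ?normr_gt0//.
rewrite -[X in (op_norm X)%:C <= _](scalerK a0) -normfV.
exact: Z_le.
Qed.

Lemma op_norm0_eq0 (T : bounded_op) : (op_norm T)%:C = 0 :> R[i] -> T = 0.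
Proof.
move=> T0; apply: op_eqP => x; apply/eqP.
rewrite -[X in _ == X]/(0 : X) -normr_le0.
by rewrite (le_trans (op_norm_ub _ _))// T0 mul0r.
Qed.

HB.instance Definition _ := Lmodule_isNormed.Build R[i] bounded_op
  op_normD op_normZ op_norm0_eq0.

Definition is_inverse (S T : bounded_op) := S * T = 1 /\ T * S = 1.

Definition op_invertible (T : bounded_op) := exists S, is_inverse T S.

Definition op_ker (T : bounded_op) : set X := [set x | T x = 0].

Definition op_im (T : bounded_op) : set X := range T.

Section KernelCokernel.
Variable Z : bounded_op.

Definition ker_pred : {pred X} := fun x => x \in op_ker Z.

Lemma ker_submod_closed : submod_closed ker_pred.
Proof.
split; first by apply/mem_set; rewrite /op_ker/= linear0.
move=> a u v /set_mem Zu /set_mem Zv; apply/mem_set.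
by rewrite /op_ker/= linearP/= Zu Zv scaler0 addr0.
Qed.

(* [ker(Z)], with the topology induced from [X] *)
Definition ker_space : Type := set_type (op_ker Z).

HB.instance Definition _ := SubChoice.copy ker_space {x : X | ker_pred x}.
HB.instance Definition _ := GRing.SubChoice_isSubLmodule.Build
  R[i] X ker_pred ker_space (GRing.submod_closed_semi ker_submod_closed).
HB.instance Definition _ := Topological.copy ker_space (set_type (op_ker Z)).

Definition im_pred : {pred X} := fun x => x \in op_im Z.

Lemma im_submod_closed : submod_closed im_pred.
Proof.
split; first by apply/mem_set; exists 0 => //; rewrite linear0.
move=> a _ _ /set_mem[x _ <-] /set_mem[y _ <-]; apply/mem_set.
by exists (a *: x + y) => //; rewrite linearP.
Qed.

HB.instance Definition _ := GRing.isZmodClosed.Build X im_pred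
  (GRing.submod_closedB im_submod_closed).

(* [X/im(Z)], with the quotient topology *)
Definition coker_space : Type := quotient_topology {ideal_quot im_pred}.

HB.instance Definition _ := GRing.Zmodule.copy coker_space {ideal_quot im_pred}.

Local Open Scope quotient_scope.

Definition coker_pi (x : X) : coker_space := \pi_{ideal_quot im_pred} x.

Lemma coker_pi_eqP (x y : X) : coker_pi x = coker_pi y <-> op_im Z (x - y).
Proof.
split=> [/eqP|/mem_set]; last by move=> xy; apply/eqP; rewrite -Quotient.idealrBE.
by rewrite -Quotient.idealrBE => /set_mem.
Qed.

Lemma coker_piD (x y : X) : coker_pi (x + y) = coker_pi x + coker_pi y.
Proof. exact: (raddfD (\pi_{ideal_quot im_pred})). Qed.

Lemma coker_pi_surj (u : coker_space) : exists x, u = coker_pi x.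
Proof. by exists (repr (u : {ideal_quot im_pred})); rewrite /coker_pi reprK. Qed.

Definition coker_scale (a : R[i]) (u : coker_space) : coker_space :=
  coker_pi (a *: repr (u : {ideal_quot im_pred})).

Lemma coker_scaleE (a : R[i]) (x : X) :
  coker_scale a (coker_pi x) = coker_pi (a *: x).
Proof.
apply/coker_pi_eqP; rewrite -scalerBr.
have /coker_pi_eqP[y _ <-] : coker_pi (repr (coker_pi x : {ideal_quot im_pred})) =
    coker_pi x by rewrite /coker_pi reprK.
by exists (a *: y) => //; rewrite linearZ.
Qed.

Lemma coker_scaleA a b u :
  coker_scale a (coker_scale b u) = coker_scale (a * b) u.
Proof.
by have [x ->] := coker_pi_surj u; rewrite !coker_scaleE scalerA.
Qed.

Lemma coker_scale1 : left_id 1 coker_scale.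
Proof.
by move=> u; have [x ->] := coker_pi_surj u; rewrite coker_scaleE scale1r.
Qed.

Lemma coker_scaleDr : right_distributive coker_scale +%R.
Proof.
move=> a u v; have [x ->] := coker_pi_surj u; have [y ->] := coker_pi_surj v.
by rewrite -coker_piD !coker_scaleE scalerDr coker_piD.
Qed.

Lemma coker_scaleDl u : {morph coker_scale^~ u : a b / a + b}.
Proof.
move=> a b; have [x ->] := coker_pi_surj u.
by rewrite !coker_scaleE scalerDl coker_piD.
Qed.

HB.instance Definition _ := GRing.Zmodule_isLmodule.Build R[i] coker_space
  coker_scaleA coker_scale1 coker_scaleDr coker_scaleDl.
HB.instance Definition _ := Topological.copy coker_space
  (quotient_topology {ideal_quot im_pred}).

End KernelCokernel.

Definition generalized_index_zero (Z : bounded_op) :=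
  exists (f : {linear ker_space Z -> coker_space Z})
         (g : coker_space Z -> ker_space Z),
    [/\ cancel f g, cancel g f, continuous f & continuous g].

(* The convergence is that of the operator norm. Convergence at small positive
   [t] already forces a positive radius of convergence. *)
Definition power_series_near0 (F : R -> bounded_op) (a : nat -> bounded_op) :=
  \forall t \near 0^'+,
    series (fun k => (t%:C : R[i]) ^+ k *: a k) n @[n --> \oo] --> F t.

Definition path_to (Z : bounded_op) (E : R -> bounded_op) (t : R) : bounded_op :=
  Z + (t%:C : R[i]) *: E t.

Definition admissible_path (Z : bounded_op) (E : R -> bounded_op) :=
  (\forall t \near 0^'+, op_invertible (path_to Z E t)) /\
  exists a, power_series_near0 E a.

Definition inverse_coefN1 (Z : bounded_op) (E : R -> bounded_op)
    (C : bounded_op) :=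
  exists (H : R -> bounded_op) (c : nat -> bounded_op),
    power_series_near0 H c /\
    \forall t \near 0^'+,
      is_inverse (path_to Z E t) ((t%:C : R[i])^-1 *: C + H t).

Definition good_path (Z : bounded_op) (E : R -> bounded_op) :=
  admissible_path Z E /\ exists C, inverse_coefN1 Z E C.

End BoundedOperators.

(* Main.v *)
Require Import Defs.
From HB Require Import structures.
From mathcomp Require Import all_boot all_order all_algebra sesquilinear.
From mathcomp Require Import complex ring lra.
From mathcomp Require Import all_classical all_reals all_analysis.

(** If [A(t) = Z + t E(t)] has inverse [C / t + C_0 + ...] and [E_1 = E(0)], then
    comparing the coefficients of [1/t] and of [1] on both sides gives
    [Z C = C Z = 0] and [Z C_0 + E_1 C = C_0 Z + C E_1 = 1].  These identities
    yield [ker C = im Z] and [im C = ker Z], and also that [ker Z] meets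
    [ker E_1] trivially, so that [n = 1] always works.

    Conversely, if [ker C = im Z] and [im C = ker Z], then all four spaces are
    closed.  Let [W] and [E] be the Moore-Penrose inverses of [Z] and [C], which
    are bounded by the open mapping theorem.  Then [Z + t E] has inverse
    [C / t + W] for every [t <> 0].  If [Z] has generalized index zero, such a [C]
    is the composite [X -> coker Z -> ker Z -> X]. *)

Set Implicit Arguments.
Unset Strict Implicit.
Unset Printing Implicit Defensive.

Import Order.TTheory GRing.Theory Num.Theory.
Import numFieldNormedType.Exports.

Local Open Scope classical_set_scope.
Local Open Scope complex_scope.
Local Open Scope ring_scope.

(** * Norms and the open mapping argument *)

Section RealNorm.
Variables (R : realType) (V : normedModType R[i]).

(** The norm of a normed module over [R[i]] takes values in [R[i]]. Its real part loses nothing and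
    lives in an ordered field, where [lra] and squeezing apply. *)
Definition rnorm (x : V) : R := complex.Re `|x|.

Lemma rnormE x : (rnorm x)%:C = `|x|. Proof. exact: normCRe. Qed.

Lemma rnorm_ge0 x : 0 <= rnorm x.
Proof. by rewrite -lecR rnormE normr_ge0. Qed.

Lemma rnorm0 : rnorm 0 = 0.
Proof. by rewrite /rnorm normr0. Qed.

Lemma rnorm_eq0 x : rnorm x = 0 -> x = 0.
Proof. by move=> x0; apply/eqP; rewrite -normr_eq0 -rnormE x0. Qed.

Lemma rnormD x y : rnorm (x + y) <= rnorm x + rnorm y.
Proof. by rewrite -lecR rmorphD /= !rnormE ler_normD. Qed.

Lemma rnormN x : rnorm (- x) = rnorm x.
Proof. by rewrite /rnorm normrN. Qed.

Lemma rdistC x y : rnorm (x - y) = rnorm (y - x).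
Proof. by rewrite /rnorm distrC. Qed.

Lemma rdistD z x y : rnorm (x - y) <= rnorm (x - z) + rnorm (z - y).
Proof. by apply: le_trans (rnormD _ _); rewrite addrA subrK. Qed.

Lemma rnormZ (a : R) x : rnorm (a%:C *: x) = `|a| * rnorm x.
Proof.
apply: complexI; rewrite rmorphM /= !rnormE normrZ normc_def /=.
by rewrite expr0n addr0 sqrtr_sqr.
Qed.

Lemma cvg_rnormP T (F : set_system T) {FF : Filter F} (f : T -> V) (l : V) :
  f @ F --> l <-> rnorm (f x - l) @[x --> F] --> 0.
Proof.
split=> [/cvgrPdist_lt fl|/cvgrPdist_lt fl]; apply/cvgrPdist_lt => e e0.
  have := fl e%:C; rewrite ltcR => /(_ e0); apply: filterS => x.
  by rewrite -rnormE ltcR sub0r normrN ger0_norm ?rnorm_ge0// rdistC.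
have eE : (complex.Re e)%:C = e by rewrite RRe_real// gtr0_real.
have := fl (complex.Re e); rewrite -ltcR eE => /(_ e0); apply: filterS => x.
by rewrite sub0r normrN ger0_norm ?rnorm_ge0// -ltcR eE rnormE distrC.
Qed.

End RealNorm.

Lemma cvg_rnorm_le (R : realType) (V : normedModType R[i]) T (F : set_system T)
    {FF : ProperFilter F} (u : T -> V) (l y : V) (B : R) :
  u @ F --> l -> (\forall x \near F, rnorm (u x - y) <= B) -> rnorm (l - y) <= B.
Proof.
move=> /cvg_rnormP ul uy.
have : (fun x => rnorm (u x - l) + B) @ F --> 0 + B.
  by apply: cvgD => //; exact: cvg_cst.
rewrite add0r => /cvgr_to_ge; apply; apply: filterS uy => x uxy.
have := rdistD (u x) l y; rewrite (rdistC l (u x)); lra.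
Qed.

(** The rate makes the sequence Cauchy, and letting [m] grow carries the rate over to the limit.
    Nested balls, successive corrections and minimizing sequences all converge through it. *)
Lemma cvg_of_rate (R : realType) (V : completeNormedModType R[i])
    (u : V^nat) (r : R^nat) :
  r @ \oo --> 0 ->
  (forall n m, (n <= m)%N -> rnorm (u m - u n) <= r n) ->
  exists2 l : V, u @ \oo --> l & forall n, rnorm (l - u n) <= r n.
Proof.
move=> r0 ur.
have [l ul] : exists l : V, u @ \oo --> l.
  apply/cvg_ex/cauchy_cvgP/cauchy_exP => e e0.
  have eE : (complex.Re e)%:C = e by rewrite RRe_real// gtr0_real.
  move/cvgrPdist_lt : r0 => /(_ (complex.Re e)); rewrite -ltcR eE => /(_ e0).
  case=> N _ rN; exists (u N), N => // m /= Nm.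
  rewrite -ball_normE/= -rnormE -eE ltcR rdistC.
  apply: le_lt_trans (ur _ _ Nm) _.
  apply: le_lt_trans (ler_norm _) _.
  by have := rN N (leqnn N); rewrite sub0r normrN.
exists l => // n; apply: (cvg_rnorm_le ul).
by exists n => // m /= /ur.
Qed.

(** Baire category by nested balls: if no [F n] were dense in any ball, shrinking balls could avoid
    [F 0], [F 1], ... in turn, and their common point would lie in no [F n]. *)
Lemma Baire_ball (R : realType) (V : completeNormedModType R[i])
    (F : (set V)^nat) : \bigcup_n F n = setT ->
  exists n (y0 : V) (r : R), 0 < r /\
    forall y, rnorm (y - y0) < r ->
    forall e : R, 0 < e -> exists2 y', F n y' & rnorm (y - y') < e.
Proof.
move=> FT; apply: contrapT => noball.
(* A pair is a centre and a radius. Positivity of the radius is a hypothesis inside the existential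
   so that [choice] yields a total function; any other pair is sent to itself. *)
have step (n : nat) (b : V * R) : exists c : V * R, 0 < b.2 ->
    [/\ 0 < c.2, c.2 <= b.2 / 2, rnorm (c.1 - b.1) + c.2 <= b.2 &
      forall y, rnorm (y - c.1) <= c.2 -> ~ F n y].
  have [b0|b0] := ltP 0 b.2; last by exists b.
  have [y yb [e e0 ye]] : exists2 y, rnorm (y - b.1) < b.2 &
      exists2 e : R, 0 < e & forall y', F n y' -> e <= rnorm (y - y').
    apply: contrapT => H; apply: noball; exists n, b.1, b.2; split=> // y yb e e0.
    apply: contrapT => H'; apply: H; exists y => //; exists e => // y' Fy'.
    by rewrite leNgt; apply/negP => yy'; apply: H'; exists y'.
  (* Half the smaller of the room left in the ball and the gap [e] to [F n]: the closed ball of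
     radius [r] about [y] stays inside, misses [F n], and the radii at least halve. *)
  pose r := Num.min (b.2 - rnorm (y - b.1)) e / 2.
  have m0 : 0 < Num.min (b.2 - rnorm (y - b.1)) e.
    by rewrite lt_min e0 subr_gt0 yb.
  have m1 : Num.min (b.2 - rnorm (y - b.1)) e <= b.2 - rnorm (y - b.1).
    by rewrite ge_min lexx.
  have m2 : Num.min (b.2 - rnorm (y - b.1)) e <= e.
    by rewrite ge_min lexx orbT.
  have := rnorm_ge0 (y - b.1) => yb0.
  exists (y, r) => _ /=; rewrite /r; split; [lra|lra|lra|].
  by move=> y' yy' /ye; rewrite rdistC; lra.
have {step}[f fP] := choice (fun nb : nat * (V * R) => step nb.1 nb.2).
pose s := fix s n := if n is m.+1 then f (m, s m) else ((0 : V), (1 : R)).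
have s_gt0 n : 0 < (s n).2.
  by elim: n => [|n IH] //=; have [] := fP (n, s n) IH.
have s_le n : (s n).2 <= 2^-1 ^+ n.
  elim: n => [|n IH] //=; have [_ + _ _] := fP (n, s n) (s_gt0 n).
  by rewrite exprS /=; lra.
(* Inclusion of the closed balls, as an inequality that telescopes and also bounds the distance
   between centres. *)
have s_nest n m : (n <= m)%N -> rnorm ((s m).1 - (s n).1) + (s m).2 <= (s n).2.
  elim: m => [|m IH]; first by rewrite leqn0 => /eqP ->; rewrite subrr rnorm0 add0r.
  rewrite leq_eqVlt => /predU1P[->|]; first by rewrite subrr rnorm0 add0r.
  rewrite ltnS => /IH nm; have [_ _ + _] := fP (m, s m) (s_gt0 m).
  rewrite -/(s m.+1) /= => sm.
  by have := rdistD (s m).1 (f (m, s m)).1 (s n).1; lra.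
have [l _ ls] : exists2 l : V, (fun n => (s n).1) @ \oo --> l &
    forall n, rnorm (l - (s n).1) <= (s n).2.
  apply: cvg_of_rate => [|n m /s_nest]; last by have := s_gt0 m; lra.
  apply: (@squeeze_cvgr _ _ _ _ (fun=> 0) (fun n => 2^-1 ^+ n)).
  - by apply: nearW => n; rewrite s_le ltW.
  - exact: cvg_cst.
  - by apply: cvg_expr; rewrite ger0_norm ?invf_lt1//; lra.
(* The limit lies in every ball, in particular in the one of index [n.+1], which was chosen to avoid
   [F n]. *)
have [n _ Fnl] : (\bigcup_n F n) l by rewrite FT.
have [_ _ _ /(_ l)] := fP (n, s n) (s_gt0 n).
by apply => //; exact: (ls n.+1).
Qed.

(** * Bounded solutions of operator equations *)

Section Operators.
Variables (R : realType) (X : hilbertType R).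
Implicit Types S T P Q : bounded_op X.

Lemma rnorm_op T x : rnorm (T x) <= rnorm T * rnorm x.
Proof. by rewrite -lecR rmorphM /= !rnormE; exact: op_norm_ub. Qed.

Lemma rnorm_mul S T : rnorm (S * T) <= rnorm S * rnorm T.
Proof.
apply: op_norm_le => x x1; rewrite -rnormE lecR.
apply: le_trans (rnorm_op S (T x)) _; rewrite ler_wpM2l ?rnorm_ge0//.
rewrite (le_trans (rnorm_op _ _))// ler_piMr ?rnorm_ge0//.
by rewrite -lecR rnormE.
Qed.

Lemma bounded_linearP (f : X -> X) (M : R) : linear f ->
  (forall x, rnorm (f x) <= M * rnorm x) -> f \in @bounded_linear R X.
Proof.
move=> lf fM; apply/asboolP; split=> //; exists M%:C => x.
by rewrite -!rnormE -rmorphM lecR.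
Qed.

Lemma cvg_op I (F : set_system I) {FF : Filter F} T (u : I -> X) (l : X) :
  u @ F --> l -> (fun i => T (u i)) @ F --> T l.
Proof.
move=> /cvg_rnormP ul; apply/cvg_rnormP.
apply: (@squeeze_cvgr _ _ _ _ (fun=> 0) (fun i => rnorm T * rnorm (u i - l))).
- by apply: nearW => i; rewrite rnorm_ge0 /= -raddfB rnorm_op.
- exact: cvg_cst.
- by rewrite -[X in _ --> X](mulr0 (rnorm T)); apply: cvgMr.
Qed.

(* The approximate solutions, averaged, are available on a ball around the
   origin, hence by homogeneity everywhere. *)
Lemma approx_solution T Q : (forall y, exists x, T x = Q y) ->
  exists2 K : R, 0 <= K & forall y, exists x y',
    [/\ T x = Q y', rnorm x <= K * rnorm y & rnorm (y - y') <= rnorm y / 2].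
Proof.
move=> TQ.
(* The points [y] for which [Q y] has a preimage of norm at most [n]; solvability makes these sets
   cover [X]. *)
pose F n := [set y | exists2 x, T x = Q y & rnorm x <= n%:R].
have [|n [y0 [r [r0 Fr]]]] := @Baire_ball R X F.
  rewrite -subTset => y _; have [x Tx] := TQ y.
  by exists (Num.truncn (rnorm x)).+1 => //; exists x => //; rewrite ltW// truncnS_gt.
exists (2 * n%:R / r) => [|y].
  by rewrite divr_ge0 ?mulr_ge0// ltW.
have [->|y_neq0] := eqVneq y 0.
  by exists 0, 0; rewrite subrr !linear0 rnorm0 mulr0 mul0r.
have y_gt0 : 0 < rnorm y.
  by rewrite lt_neqAle rnorm_ge0 andbT eq_sym; apply: contra_neq y_neq0 => /rnorm_eq0.
(* Scaling by [s] gives [y] norm [r / 2], so that [y0 + s y] and [y0 - s y] both lie in the ball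
   where [F n] is dense. *)
pose s := r / (2 * rnorm y).
have s0 : 0 < s by rewrite divr_gt0// mulr_gt0.
have sy : rnorm (s%:C *: y) < r.
  rewrite rnormZ gtr0_norm// /s invfM mulrA divfK ?gt_eqF//; lra.
have r4 : 0 < r / 4 by lra.
have [|y1 [x1 Tx1 x1n] yy1] := Fr (y0 + s%:C *: y) _ _ r4.
  by rewrite addrAC subrr add0r.
have [|y2 [x2 Tx2 x2n] yy2] := Fr (y0 - s%:C *: y) _ _ r4.
  by rewrite addrAC subrr add0r rnormN.
(* Half the difference of these two points, rescaled, is [y]. As [c = rnorm y / r], two errors of
   [r / 4] become [rnorm y / 2], and two preimages of norm [n] give the constant [2 n / r]. *)
pose c : R := (2 * s)^-1.
have c0 : 0 < c by rewrite invr_gt0 mulr_gt0.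
exists (c%:C *: (x1 - x2)), (c%:C *: (y1 - y2)); split.
- by rewrite !linearZ /= !linearB /= Tx1 Tx2.
- rewrite rnormZ gtr0_norm//.
  have -> : 2 * n%:R / r * rnorm y = c * (2 * n%:R).
    by rewrite /c /s; field; rewrite !gt_eqF.
  rewrite ler_pM2l// (le_trans (rnormD _ _))// rnormN; lra.
- have -> : y - c%:C *: (y1 - y2) =
     c%:C *: ((y0 + s%:C *: y - y1) - (y0 - s%:C *: y - y2)).
    have {1}-> : y = c%:C *: (s%:C *: y + s%:C *: y).
      rewrite -scalerDl scalerA -rmorphD -rmorphM /c.
      have -> : (2 * s)^-1 * (s + s) = 1 by field; rewrite gt_eqF.
      by rewrite scale1r.
    rewrite -scalerBr; congr (_ *: _).
    rewrite !opprD !opprK !addrA.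
    by rewrite [RHS](ACl (1*4*2*5*3*6))%AC /= subrr add0r.
  rewrite rnormZ gtr0_norm//.
  have -> : rnorm y / 2 = c * (r / 4 + r / 4).
    by rewrite /c /s; field; rewrite !gt_eqF.
  rewrite ler_pM2l// (le_trans (rnormD _ _))// rnormN; lra.
Qed.

(** Solve approximately, then solve again for the residual, and so on. Residuals halve at each
    round, so the corrections form a geometric series whose total norm is at most [2 K rnorm y]. *)
Lemma bounded_solution T Q : (forall y, exists x, T x = Q y) ->
  exists K : R, forall y, exists2 x, T x = Q y & rnorm x <= K * rnorm y.
Proof.
move=> /approx_solution[K K0 H].
have {}H y : exists p : X * X,
    [/\ T p.1 = Q p.2, rnorm p.1 <= K * rnorm y & rnorm (y - p.2) <= rnorm y / 2].
  by have [x [y' xy']] := H y; exists (x, y').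
have {H}[g gP] := choice H.
exists (2 * K) => y.
pose s := fix s n := if n is m.+1 then s m - (g (s m)).2 else y.
have s_le n : rnorm (s n) <= rnorm y * 2^-1 ^+ n.
  elim: n => [|n IH]; first by rewrite expr0 mulr1.
  have [_ _ h] := gP (s n); apply: le_trans h _.
  by rewrite exprSr mulrA ler_pM2r// invr_gt0.
pose u n := \sum_(i < n) (g (s i)).1.
have uS n : u n.+1 = u n + (g (s n)).1 by rewrite /u big_ord_recr.
have Tu n : T (u n) = Q (y - s n).
  elim: n => [|n IH]; first by rewrite /u big_ord0 subrr !linear0.
  have [+ _ _] := gP (s n); rewrite uS linearD /= IH => ->.
  by rewrite -linearD /= opprB addrA addrAC.
have r_cvg M : (fun n => M * 2^-1 ^+ n : R) @ \oo --> 0.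
  rewrite -[X in _ --> X](mulr0 M); apply: cvgMr.
  by apply: cvg_expr; rewrite ger0_norm ?invf_lt1//; lra.
have [] := @cvg_of_rate R X u (fun n => (2 * K * rnorm y) * 2^-1 ^+ n) (r_cvg _).
  move=> n m nm.
  (* Adding the remaining tail on the left makes the bound inductive: each correction is paid for by
     the drop in the tail. *)
  suff : rnorm (u m - u n) + 2 * K * rnorm y * 2^-1 ^+ m <=
      2 * K * rnorm y * 2^-1 ^+ n.
    apply: le_trans; rewrite lerDl mulr_ge0 ?exprn_ge0// ?invr_ge0//.
    by rewrite !mulr_ge0 ?rnorm_ge0.
  elim: m nm => [|m IH]; first by rewrite leqn0 => /eqP ->; rewrite subrr rnorm0 add0r.
  rewrite leq_eqVlt => /predU1P[->|]; first by rewrite subrr rnorm0 add0r.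
  rewrite ltnS => /IH; have [_ + _] := gP (s m).
  have := rdistD (u m) (u m.+1) (u n).
  have -> : u m.+1 - u m = (g (s m)).1 by rewrite uS addrAC subrr add0r.
  rewrite exprS.
  have := ler_wpM2l K0 (s_le m).
  lra.
move=> x ux xP; exists x; last first.
  by have := xP 0%N; rewrite /u big_ord0 subr0 expr0 mulr1.
have s0 : s @ \oo --> (0 : X).
  apply/cvg_rnormP.
  apply: (@squeeze_cvgr _ _ _ _ (fun=> 0) (fun n => rnorm y * 2^-1 ^+ n)).
  - by apply: nearW => n; rewrite rnorm_ge0 subr0 s_le.
  - exact: cvg_cst.
  - exact: r_cvg.
(* The sequence [T (u n) = Q (y - s n)] tends both to [T x] and to [Q y]. *)
have := cvg_op (T := T) ux; rewrite (funext Tu).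
have : (fun n => Q (y - s n)) @ \oo --> Q y.
  apply: cvg_op; rewrite -[X in _ --> X]subr0; apply: cvgB => //; exact: cvg_cst.
by move=> h1 h2; exact: (norm_cvg_unique (h2 _) h1).
Qed.

End Operators.

(** * Orthogonal projections and pseudo-inverses *)

Section Projection.
Variables (R : realType) (X : hilbertType R).

Local Notation "''[' u , v ]" := (@inner R X u v).

Lemma inner_rnorm (x : X) : '[x, x] = (rnorm x ^+ 2)%:C.
Proof. by rewrite rmorphXn /= rnormE inner_norm. Qed.

Lemma parallelogram (a b : X) :
  rnorm (a + b) ^+ 2 + rnorm (a - b) ^+ 2 = (rnorm a ^+ 2 + rnorm b ^+ 2) *+ 2.
Proof.
apply: complexI; rewrite rmorphMn !rmorphD /= -!inner_rnorm dnormD dnormB /=.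
by rewrite addrACA subrr addr0 mulr2n.
Qed.

Variable V : set X.
Hypotheses (V_closed : closed V) (V0 : V 0).
Hypothesis V_linear : forall a u v, V u -> V v -> V (a *: u + v).

(** A minimizing sequence is Cauchy: the parallelogram law bounds the gap between two terms, because
    their midpoint lies in [V] and cannot beat the infimum. *)
Lemma nearest_point x :
  exists2 p, V p & forall v, V v -> rnorm (x - p) <= rnorm (x - v).
Proof.
pose D := [set rnorm (x - v) ^+ 2 | v in V].
have D_inf : has_inf D.
  split; first by exists (rnorm (x - 0) ^+ 2), 0.
  by exists 0 => _ [v _ <-]; rewrite sqr_ge0.
pose q n : R := 2^-1 ^+ n.
have q_gt0 n : 0 < q n by rewrite exprn_gt0.
(* The slack is squared because it concerns squared distances; the parallelogram law then gives
   [rnorm (u m - u n) <= 2 * q n]. *)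
have approx n : exists v, V v /\ rnorm (x - v) ^+ 2 < inf D + q n ^+ 2.
  have [_ [v Vv <-] vq] := inf_adherent (exprn_gt0 2 (q_gt0 n)) D_inf.
  by exists v.
have {approx}[u uP] := choice approx.
have D_le v : V v -> inf D <= rnorm (x - v) ^+ 2.
  by move=> Vv; apply: inf_lbound; [exact: D_inf.2|exists v].
have q_cvg M : (fun n => M * q n) @ \oo --> 0.
  rewrite -[X in _ --> X](mulr0 M); apply: cvgMr.
  by apply: cvg_expr; rewrite ger0_norm ?invf_lt1//; lra.
have q_le n m : (n <= m)%N -> q m <= q n.
  by move=> nm; rewrite /q ler_wiXn2l ?invr_ge0// invf_le1//; lra.
have [|p up pP] := @cvg_of_rate R X u _ (q_cvg 2).
  move=> n m nm.
  have := parallelogram (x - u n) (x - u m).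
  have -> : (x - u n) - (x - u m) = u m - u n.
    by rewrite opprB addrC addrA subrK.
  have -> : (x - u n) + (x - u m) = 2%:C *: (x - 2^-1%:C *: (1 *: u n + u m)).
    rewrite scalerBr scalerA -rmorphM divff// !scale1r.
    by rewrite [2%:C]rmorphD scalerDl scale1r opprD addrACA.
  rewrite rnormZ exprMn normr_nat.
  have Vmid : V (2^-1%:C *: (1 *: u n + u m)).
    rewrite -[_ *: _]addr0; apply: V_linear => //.
    by apply: V_linear; have [] := uP n; have [] := uP m.
  have := D_le _ Vmid.
  have [_] := uP n; have [_] := uP m; have := q_le _ _ nm.
  have qn0 := q_gt0 n; have qm0 := q_gt0 m => qmn.
  have : q m ^+ 2 <= q n ^+ 2 by rewrite ler_sqr ?nnegrE ?(ltW qn0) ?(ltW qm0).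
  move=> h1 h2 h3 h4 h5.
  rewrite -ler_sqr ?nnegrE ?rnorm_ge0 ?mulr_ge0 ?(ltW qn0)// exprMn; lra.
exists p.
  have Vu : \forall n \near \oo, V (u n) by apply: nearW => n; have [] := uP n.
  exact: (closed_cvg V V_closed Vu p up).
move=> v Vv.
(* One [q n] comes from the near-minimality of [u n], two from its distance to [p]. *)
have : (fun n => rnorm (x - v) + 3 * q n) @ \oo --> rnorm (x - v).
  by rewrite -[X in _ --> X]addr0; apply: cvgD; [exact: cvg_cst|exact: q_cvg].
move/cvgr_to_ge; apply; apply: nearW => n.
have uv : rnorm (x - u n) <= rnorm (x - v) + q n.
  rewrite -ler_sqr ?nnegrE ?addr_ge0 ?rnorm_ge0 ?(ltW (q_gt0 _))//.
  have [_] := uP n; have := D_le _ Vv.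
  have := mulr_ge0 (rnorm_ge0 (x - v)) (ltW (q_gt0 n)); lra.
have := rdistD (u n) x p; have := pP n; rewrite (rdistC p); lra.
Qed.

Lemma orthogonal_decomposition x :
  exists2 p, V p & forall v, V v -> '[x - p, v] = 0.
Proof.
have [p Vp pP] := nearest_point x; exists p => // v Vv.
have [->|v0] := eqVneq v 0; first by rewrite linear0r.
have vv0 : 0 < '[v, v] by rewrite dnorm_gt0.
(* Moving [p] by the component of [x - p] along [v] lowers the squared distance by [|a|^2 '[v, v]],
   which minimality forces to vanish. *)
pose a := '[x - p, v] / '[v, v].
have : rnorm (x - p) <= rnorm (x - p - a *: v).
  by rewrite -addrA -opprD; apply: pP; rewrite addrC; exact: V_linear.
rewrite -ler_sqr ?nnegrE ?rnorm_ge0// -lecR -!inner_rnorm.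
have dE : '[x - p, a *: v] = `|a| ^+ 2 * '[v, v].
  have av : '[x - p, v] = a * '[v, v] by rewrite /a divfK ?gt_eqF.
  by rewrite linearZr_LR /= normCK av mulrA [X in X * _]mulrC.
have d_ge0 : 0 <= `|a| ^+ 2 * '[v, v] by rewrite mulr_ge0 ?exprn_ge0 ?(ltW vv0).
rewrite (dnormB _ (x - p)) (dnormZ (@inner R X)) dE geC0_conj//.
rewrite opprD addrA addrK lerDl oppr_ge0 => d_le0.
have /eqP := le_anti (introT andP (conj d_le0 d_ge0)).
rewrite mulf_eq0 expf_eq0 /= normr_eq0 (gt_eqF vv0) orbF mulf_eq0 invr_eq0.
by rewrite (gt_eqF vv0) orbF => /eqP.
Qed.

(** Uniqueness of the orthogonal decomposition makes the projection linear, and Pythagoras bounds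
    its norm by 1. *)
Lemma orthogonal_projection : exists P : bounded_op X,
  (forall x, V (P x)) /\ (forall x, V x -> P x = x).
Proof.
have decomp x : exists p, V p /\ forall v, V v -> '[x - p, v] = 0.
  by have [p] := orthogonal_decomposition x; exists p.
have {decomp}[p pP] := choice decomp.
(* The difference of two candidates lies in [V] and is orthogonal to [V], hence to itself. *)
have p_uniq x y : V y -> (forall v, V v -> '[x - y, v] = 0) -> p x = y.
  move=> Vy xy; have [Vp xp] := pP x.
  apply/eqP; rewrite -subr_eq0 -(dnorm_eq0 (@inner R X)); apply/eqP.
  have Vpy : V (p x - y) by rewrite addrC -scaleN1r; exact: V_linear.
  have {1}-> : p x - y = (x - y) - (x - p x).
    by rewrite opprB [RHS]addrC addrA subrK.
  by rewrite linearBl /= xy// xp// subrr.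
have p_linear : linear p.
  move=> a x y; have [Vx xP] := pP x; have [Vy yP] := pP y.
  apply: p_uniq => [|v Vv]; first exact: V_linear.
  have -> : a *: x + y - (a *: p x + p y) = a *: (x - p x) + (y - p y).
    by rewrite scalerBr opprD addrACA.
  by rewrite linearDl /= linearZl_LR /= xP// yP// mulr0 addr0.
have p_bounded x : rnorm (p x) <= 1 * rnorm x.
  rewrite mul1r -ler_sqr ?nnegrE ?rnorm_ge0// -lecR -!inner_rnorm; have [Vx xP] := pP x.
  by rewrite -{3 4}(subrK (p x) x) (hnormDd (xP _ Vx)) lerDr dnorm_ge0.
exists (BoundedOp (bounded_linearP p_linear p_bounded)); split => x /=.
  by have [] := pP x.
by move=> Vx; apply: p_uniq => // v _; rewrite subrr linear0l.
Qed.

End Projection.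

Section PseudoInverse.
Variables (R : realType) (X : hilbertType R).
Implicit Types C E P Q S T W Z : bounded_op X.

Lemma op_scalerAl (a : R[i]) S T : a *: S * T = a *: (S * T).
Proof. exact: op_eqP. Qed.

Lemma op_scalerAr (a : R[i]) S T : S * (a *: T) = a *: (S * T).
Proof. by apply: op_eqP => x; exact: linearZ. Qed.

Lemma op_mul_eq0 S T : op_im T `<=` op_ker S -> S * T = 0.
Proof. by move=> TS; apply: op_eqP => x; apply: TS; exists x. Qed.

Lemma closed_op_ker T : closed (op_ker T).
Proof.
have -> : op_ker T = T @^-1` [set 0] by [].
apply: preimage_closed; last first.
  exact/accessible_closed_set1/hausdorff_accessible/norm_hausdorff.
by move=> x _; apply: cvg_op; exact: cvg_id.
Qed.

Definition ker_projection T P :=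
  (forall x, T (P x) = 0) /\ (forall x, T x = 0 -> P x = x).

Lemma ker_projection_exists T : exists P, ker_projection T P.
Proof.
have T0 : op_ker T 0 by rewrite /op_ker /= linear0.
have T_lin a u v : op_ker T u -> op_ker T v -> op_ker T (a *: u + v).
  by rewrite /op_ker /= linearP /= => -> ->; rewrite scaler0 addr0.
exact: orthogonal_projection (@closed_op_ker T) T0 T_lin.
Qed.

Section KerProjection.
Variables T P : bounded_op X.
Hypothesis TP : ker_projection T P.

Lemma ker_projection_mul : T * P = 0.
Proof. by apply: op_eqP => x; exact: TP.1. Qed.

Lemma ker_projection_id S : T * S = 0 -> P * S = S.
Proof.
by move=> TS; apply: op_eqP => x; apply: TP.2; rewrite -[LHS]/((T * S) x) TS.
Qed.

(** [T] and [P] are jointly injective, since [P] fixes whatever [T] kills. An operator identity can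
    thus be checked after composing with each of them. *)
Lemma ker_projection_cancel S S' : T * S = T * S' -> P * S = P * S' -> S = S'.
Proof.
move=> TS PS; have : P * (S - S') = S - S'.
  by apply: ker_projection_id; rewrite mulrBr TS subrr.
by rewrite mulrBr PS subrr => /esym/subr0_eq.
Qed.

(** Among the solutions of [T x = Q y], exactly one is killed by [P]. Uniqueness makes it linear in
    [y]; it arises from a bounded solution by subtracting the [P] component, so it stays bounded. *)
Lemma pseudo_inverse Q :
  (forall y, exists x, T x = Q y) -> exists W, T * W = Q /\ P * W = 0.
Proof.
move=> /bounded_solution[K H]; have [TP0 PT] := TP.
have sol y : exists x,
    [/\ T x = Q y, P x = 0 & rnorm x <= (1 + rnorm P) * K * rnorm y].
  have [x Tx xK] := H y; exists (x - P x); split.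
  - by rewrite linearB /= TP0 subr0.
  - by rewrite linearB /= (PT (P x)) ?subrr.
  - rewrite (le_trans (rnormD _ _))// rnormN.
    have := rnorm_op P x; have := ler_wpM2l (rnorm_ge0 P) xK; lra.
have {H sol}[w wP] := choice sol.
have uniq x x' : T x = T x' -> P x = P x' -> x = x'.
  move=> Txx' Pxx'; have : P (x - x') = x - x'.
    by apply: PT; rewrite linearB /= Txx' subrr.
  by rewrite linearB /= Pxx' subrr => /esym/subr0_eq.
have w_lin : linear w.
  move=> a x y; have [Tx Px _] := wP x; have [Ty Py _] := wP y.
  have [Txy Pxy _] := wP (a *: x + y).
  by apply: uniq; rewrite linearP /= ?Tx ?Ty ?Px ?Py ?scaler0 ?addr0// Txy linearP.
have w_bounded x : rnorm (w x) <= (1 + rnorm P) * K * rnorm x.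
  by have [] := wP x.
exists (BoundedOp (bounded_linearP w_lin w_bounded)).
by split; apply: op_eqP => x; have [] := wP x.
Qed.

End KerProjection.

(** With [P] projecting onto [ker Z = im C] and [Q] onto [ker C = im Z], the solutions of [Z W = Q]
    and [C E = P] satisfy [W Z = 1 - P] and [E C = 1 - Q]. *)
Lemma matched_pseudo_inverses C Z :
  op_ker C = op_im Z -> op_im C = op_ker Z -> exists E W,
  [/\ E * C + Z * W = 1, C * E + W * Z = 1, E * W = 0 & W * E = 0].
Proof.
move=> kerC imC.
have ZC : Z * C = 0 by apply: op_mul_eq0; rewrite imC.
have CZ : C * Z = 0 by apply: op_mul_eq0; rewrite kerC.
have [P pP] := ker_projection_exists Z.
have [Q pQ] := ker_projection_exists C.
have [W [ZW PW]] : exists W, Z * W = Q /\ P * W = 0.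
  apply: pseudo_inverse => // y.
  have : op_ker C (Q y) by exact: pQ.1.
  by rewrite kerC => -[x _ <-]; exists x.
have [E [CE QE]] : exists E, C * E = P /\ Q * E = 0.
  apply: pseudo_inverse => // y.
  have : op_ker Z (P y) by exact: pP.1.
  by rewrite -imC => -[x _ <-]; exists x.
have ZP := ker_projection_mul pP; have CQ := ker_projection_mul pQ.
have PP := ker_projection_id pP ZP; have QQ := ker_projection_id pQ CQ.
have PC := ker_projection_id pP ZC; have QZ := ker_projection_id pQ CZ.
exists E, W; split.
- rewrite ZW; apply: (ker_projection_cancel pQ).
    by rewrite mulrDr mulrA CE PC CQ addr0 mulr1.
  by rewrite mulrDr mulrA QE mul0r add0r QQ mulr1.
- rewrite CE; apply: (ker_projection_cancel pP).
    by rewrite mulrDr ZP add0r mulrA ZW QZ mulr1.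
  by rewrite mulrDr PP mulrA PW mul0r addr0 mulr1.
- apply: (ker_projection_cancel pQ).
    by rewrite mulrA CE PW mulr0.
  by rewrite mulrA QE mul0r mulr0.
- apply: (ker_projection_cancel pP).
    by rewrite mulrA ZW QE mulr0.
  by rewrite mulrA PW mul0r mulr0.
Qed.

Lemma power_series_near0_cst E :
  power_series_near0 (fun=> E) (fun k => if k is 0%N then E else 0).
Proof.
(* The partial sum of index 0 is empty; from index 1 on it equals [E]. *)
apply: nearW => t; apply: cvg_near_cst; exists 1%N => // -[//|n] _.
rewrite /series /= big_nat_recl// expr0 scale1r big1 ?addr0// => i _.
by rewrite scaler0.
Qed.

(** In [(Z + t E) (C / t + W)] the coefficients of [1/t], [1] and [t] are [Z C = 0], [Z W + E C = 1]
    and [E W = 0]; the product in the other order is symmetric. *)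
Lemma good_path_exists C Z : op_ker C = op_im Z -> op_im C = op_ker Z ->
  exists E : R -> bounded_op X, good_path Z E /\ inverse_coefN1 Z E C.
Proof.
move=> kerC imC.
have [E [W [ECZW CEWZ EW WE]]] := matched_pseudo_inverses kerC imC.
have ZC : Z * C = 0 by apply: op_mul_eq0; rewrite imC.
have CZ : C * Z = 0 by apply: op_mul_eq0; rewrite kerC.
have inv : \forall t \near 0^'+,
    is_inverse (path_to Z (fun=> E) t) ((t%:C : R[i])^-1 *: C + W).
  near=> t.
  have t0 : (t%:C : R[i]) != 0.
    by rewrite fmorph_eq0 gt_eqF.
  rewrite /is_inverse /path_to !(mulrDl, mulrDr) !(op_scalerAl, op_scalerAr).
  rewrite ZC CZ EW WE !scalerA ?mulfV ?mulVf// !scale1r !scaler0 !add0r !addr0.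
  by rewrite [Z * W + _]addrC ECZW CEWZ.
have invC : inverse_coefN1 Z (fun=> E) C.
  exists (fun=> W); eexists; split; last exact: inv.
  exact: power_series_near0_cst.
exists (fun=> E); split=> //; split; last by exists C.
split; last by eexists; exact: power_series_near0_cst.
by apply: filterS inv => t; exists ((t%:C : R[i])^-1 *: C + W).
Unshelve. all: by end_near. Qed.

End PseudoInverse.

(** * Coefficients at a simple pole *)

Lemma cvg_real_complex (R : realType) :
  (t%:C : R[i]^o) @[t --> (0 : R)^'+] --> (0 : R[i]^o).
Proof.
apply/cvgr0Pnorm_lt => e e0.
have eE : (complex.Re e)%:C = e by rewrite RRe_real// gtr0_real.
near=> t.
rewrite ger0_norm ?lecR// -eE ltcR.
near: t; apply: nbhs_right_lt; rewrite -ltcR eE//.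
Unshelve. all: by end_near. Qed.

Section PowerSeries.
Variables (R : realType) (X : hilbertType R).
Implicit Types (C S T Z : bounded_op X) (E F G H : R -> bounded_op X).
Implicit Types (a c : nat -> bounded_op X).

Lemma cvg_op_mul I (D : set_system I) {FD : Filter D} (F G : I -> bounded_op X) S T :
  F @ D --> S -> G @ D --> T -> (fun i => F i * G i) @ D --> S * T.
Proof.
move=> /cvg_rnormP FS /cvg_rnormP GT; apply/cvg_rnormP.
pose b i := rnorm (F i - S) * rnorm (G i - T) + rnorm (F i - S) * rnorm T +
  rnorm S * rnorm (G i - T).
apply: (@squeeze_cvgr _ _ _ _ (fun=> 0) b).
- apply: nearW => i; rewrite rnorm_ge0 /=.
  have -> : F i * G i - S * T =
      (F i - S) * (G i - T) + (F i - S) * T + S * (G i - T).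
    by rewrite -mulrDr subrK mulrBl mulrBr addrA subrK.
  have := rnormD ((F i - S) * (G i - T) + (F i - S) * T) (S * (G i - T)).
  have := rnormD ((F i - S) * (G i - T)) ((F i - S) * T).
  have := rnorm_mul (F i - S) (G i - T); have := rnorm_mul (F i - S) T.
  have := rnorm_mul S (G i - T); rewrite /b; lra.
- exact: cvg_cst.
- have : b @ D --> 0 * 0 + 0 * rnorm T + rnorm S * 0.
    by apply: cvgD; [apply: cvgD|]; apply: cvgM => //; exact: cvg_cst.
  by rewrite !mul0r mulr0 !addr0.
Qed.

(** Convergence at a single [t0 > 0] bounds all [t0 ^+ k * rnorm (a k)] by some [M]. For
    [t <= t0 / 2] a geometric comparison gives [rnorm (F t - a 0) <= 2 M t / t0]. *)
Lemma power_series_near0_cvg F a :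
  power_series_near0 F a -> F t @[t --> 0^'+] --> a 0%N.
Proof.
move=> Fa.
have [t0 [t0_gt0 /= st0]] := filter_ex (filterI (nbhs_right_gt 0) Fa).
have rnorm_term (t : R) k : 0 < t ->
    rnorm ((t%:C : R[i]) ^+ k *: a k) = t ^+ k * rnorm (a k).
  by move=> t_gt0; rewrite -rmorphXn rnormZ ger0_norm// exprn_ge0// ltW.
have [M M_gt0 aM] : exists2 M : R, 0 < M & forall k, t0 ^+ k * rnorm (a k) <= M.
  have /cvg_rnormP term0 := cvg_series_cvg_0 (cvgP _ st0).
  have /pinfty_ex_gt0[M M_gt0 MP] := cvg_seq_bounded (cvgP _ term0).
  exists M => // k; rewrite -rnorm_term//.
  by have := MP k I; rewrite /= subr0 ger0_norm ?rnorm_ge0.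
apply/cvg_rnormP.
apply: (@squeeze_cvgr _ _ _ _ (fun=> 0) (fun t => 2 * M / t0 * t)).
- near=> t.
  have t_gt0 : 0 < t by near: t; exact: nbhs_right_gt.
  pose r := t / t0.
  have r_ge0 : 0 <= r by rewrite divr_ge0 ?ltW.
  have r_le : r <= 2^-1.
    rewrite ler_pdivrMr// mulrC ltW//.
    by near: t; apply: nbhs_right_lt; rewrite divr_gt0.
  rewrite rnorm_ge0 /=.
  have : series (fun k => (t%:C : R[i]) ^+ k *: a k) n @[n --> \oo] --> F t.
    by near: t; exact: Fa.
  set s := series _; rewrite -cvg_shiftS => sF; apply: (cvg_rnorm_le sF).
  apply: nearW => n.
  have s_le : rnorm (s n.+1 - a 0%N) <= M * r * (2 - 2 * 2^-1 ^+ n).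
    elim: n => [|n IH].
      rewrite /s /series /= big_nat1 expr0 scale1r subrr rnorm0.
      by rewrite expr0 mulr1 subrr mulr0.
    have -> : s n.+2 - a 0%N =
        (s n.+1 - a 0%N) + (t%:C : R[i]) ^+ n.+1 *: a n.+1.
      by rewrite /s /series /= big_nat_recr//= addrAC.
    apply: le_trans (rnormD _ _) _; rewrite rnorm_term//.
    have -> : t ^+ n.+1 * rnorm (a n.+1) =
        r ^+ n.+1 * (t0 ^+ n.+1 * rnorm (a n.+1)).
      by rewrite mulrA -exprMn divfK ?gt_eqF.
    have h1 := ler_wpM2l (exprn_ge0 n.+1 r_ge0) (aM n.+1).
    have h2 : r ^+ n <= 2^-1 ^+ n by rewrite lerXn2r// nnegrE invr_ge0.
    have h3 := ler_wpM2l (mulr_ge0 (ltW M_gt0) r_ge0) h2.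
    move: h1 h3 IH; rewrite !exprS; lra.
  have -> : 2 * M / t0 * t = 2 * (M * r) by rewrite /r; ring.
  have q_ge0 : 0 <= (2^-1 : R) ^+ n by rewrite exprn_ge0 ?invr_ge0.
  have := mulr_ge0 (mulr_ge0 (ltW M_gt0) r_ge0) q_ge0; lra.
- exact: cvg_cst.
- rewrite -[X in _ --> X](mulr0 (2 * M / t0)); apply: cvgMr.
  exact: cvg_at_right_filter cvg_id.
Unshelve. all: by end_near. Qed.

(** This recovers [E] from the expansion of the path [Z + t E(t)]: remove the constant term and
    divide by [t]. *)
Lemma power_series_near0_shift F a : power_series_near0 F a ->
  power_series_near0 (fun t => (t%:C : R[i])^-1 *: (F t - a 0%N)) (fun k => a k.+1).
Proof.
move=> Fa; near=> t.
have t0 : (t%:C : R[i]) != 0 by rewrite fmorph_eq0 gt_eqF.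
have : (fun n => series (fun k => (t%:C : R[i]) ^+ k *: a k) n) @ \oo --> F t.
  by near: t.
rewrite -cvg_shiftS => Ft.
have -> : series (fun k => (t%:C : R[i]) ^+ k *: a k.+1) =
   (fun n => (t%:C : R[i])^-1 *:
      (series (fun k => (t%:C : R[i]) ^+ k *: a k) n.+1 - a 0%N)).
  apply/funext => n; rewrite /series /= big_nat_recl// expr0 scale1r addrAC subrr add0r.
  rewrite scaler_sumr; apply: eq_bigr => i _.
  by rewrite scalerA exprS mulKf.
by apply: cvgZr; apply: cvgB => //; exact: cvg_cst.
Unshelve. all: by end_near. Qed.

(** Multiplying by [t] and letting [t] tend to 0 isolates [C], which must vanish; then [G] is
    eventually constant. *)
Lemma simple_pole_eq C G S T : G t @[t --> 0^'+] --> S ->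
  (\forall t \near 0^'+, (t%:C : R[i])^-1 *: C + G t = T) -> C = 0 /\ S = T.
Proof.
move=> GS CGT.
have C0 : C = 0.
  have : (fun t : R => (t%:C : R[i]) *: (T - G t)) @ 0^'+ --> (0 : R[i]) *: (T - S).
    by apply: cvgZ; [exact: cvg_real_complex|apply: cvgB => //; exact: cvg_cst].
  rewrite scale0r => lim0; apply: (norm_cvg_unique _ lim0); apply: cvg_near_cst.
  near=> t.
  have t0 : (t%:C : R[i]) != 0 by rewrite fmorph_eq0 gt_eqF.
  have <- : (t%:C : R[i])^-1 *: C + G t = T by near: t.
  by rewrite addrK scalerA mulfV// scale1r.
split=> //; apply: (norm_cvg_unique GS); apply: cvg_near_cst.
by apply: filterS CGT => t; rewrite C0 scaler0 add0r.
Unshelve. all: by end_near. Qed.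

(** Both products of the path with its inverse equal 1. Once multiplied out, each is a [1/t] term
    plus a remainder with a limit at 0, and [simple_pole_eq] compares the two; [T] is the constant
    coefficient of the inverse. *)
Lemma simple_pole_coefs Z E S C : E t @[t --> 0^'+] --> S ->
  inverse_coefN1 Z E C ->
  exists T, [/\ Z * C = 0, C * Z = 0, Z * T + S * C = 1 & T * Z + C * S = 1].
Proof.
move=> ES [H [c [/power_series_near0_cvg HT inv]]]; exists (c 0%N).
have mul0 (U V : bounded_op X) (F G : R -> bounded_op X) :
    F t @[t --> 0^'+] --> U -> G t @[t --> 0^'+] --> V ->
    (fun t : R => (t%:C : R[i]) *: (F t * G t)) @ 0^'+ --> 0.
  move=> FU GV; rewrite -[X in _ --> X](scale0r (U * V)).
  by apply: cvgZ; [exact: cvg_real_complex|exact: cvg_op_mul].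
have cst (U : bounded_op X) : (fun=> U) @ (0 : R)^'+ --> U by exact: cvg_cst.
have [ZC ZT] : Z * C = 0 /\ Z * c 0%N + S * C + 0 = 1.
  apply: (simple_pole_eq
      (G := fun t => Z * H t + E t * C + (t%:C : R[i]) *: (E t * H t))).
    apply: cvgD; last exact: mul0 ES HT.
    by apply: cvgD; exact: cvg_op_mul.
  near=> t; have [<- _] : is_inverse (path_to Z E t) ((t%:C : R[i])^-1 *: C + H t).
    by near: t.
  have t0 : (t%:C : R[i]) != 0 by rewrite fmorph_eq0 gt_eqF.
  rewrite /path_to mulrDl !mulrDr !(op_scalerAl, op_scalerAr) !scalerA.
  by rewrite ?mulfV ?mulVf// scale1r !addrA.
have [CZ TZ] : C * Z = 0 /\ c 0%N * Z + C * S + 0 = 1.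
  apply: (simple_pole_eq
      (G := fun t => H t * Z + C * E t + (t%:C : R[i]) *: (H t * E t))).
    apply: cvgD; last exact: mul0 HT ES.
    by apply: cvgD; exact: cvg_op_mul.
  near=> t; have [_ <-] : is_inverse (path_to Z E t) ((t%:C : R[i])^-1 *: C + H t).
    by near: t.
  have t0 : (t%:C : R[i]) != 0 by rewrite fmorph_eq0 gt_eqF.
  rewrite /path_to mulrDr !mulrDl !(op_scalerAl, op_scalerAr) !scalerA.
  by rewrite ?mulfV ?mulVf// scale1r !addrA.
by move: ZT TZ; rewrite !addr0; split.
Unshelve. all: by end_near. Qed.

End PowerSeries.

(** * Generalized index zero and the characterization of good paths *)

Lemma index_zero_op (R : realType) (X : hilbertType R) (Z : bounded_op X) :
  generalized_index_zero Z ->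
  exists C : bounded_op X, op_ker C = op_im Z /\ op_im C = op_ker Z.
Proof.
move=> [f [g [fK gK _ g_cont]]].
(* Only [f] is given as linear; its inverse inherits linearity by cancellation. *)
have g_lin a u v : g (a *: u + v) = a *: g u + g v.
  by rewrite -[LHS]fK -[RHS]fK gK linearP !gK.
pose h (x : X) : X := \val (g (coker_pi Z x)).
have h_lin : linear h.
  by move=> a x y; rewrite /h coker_piD -coker_scaleE g_lin.
have h_cont : continuous h.
  have pi_cont : continuous (coker_pi Z) by exact: pi_continuous.
  have val_cont : continuous (\val : ker_space Z -> X) by exact: initial_continuous.
  move=> x; apply: (continuous_comp (f := g \o coker_pi Z)); last exact: val_cont.
  by apply: continuous_comp; [exact: pi_cont|exact: g_cont].
pose hL : {linear X -> X} := HB.pack h (GRing.isLinear.Build _ _ _ _ _ h_lin).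
have [M _ hM] : exists2 M : R[i], 0 < M & forall x, `|h x| <= M * `|x|.
  apply/pinfty_ex_gt0/(linear_boundedP hL).
  exact/linear_bounded_continuous.
have hB : h \in @bounded_linear R X by apply/asboolP; split=> //; exists M.
have pi0 : coker_pi Z 0 = 0.
  by apply: (@addrI _ (coker_pi Z 0)); rewrite -coker_piD !addr0.
exists (BoundedOp hB); split; apply/seteqP; split.
(* As [g] is injective and the inclusion of [ker Z] too, the kernel of [h] is that of the quotient
   map, namely [im Z]. *)
- move=> x; rewrite /op_ker /= /h => hx.
  have /(congr1 f) : g (coker_pi Z x) = 0 by exact: val_inj.
  rewrite gK linear0 => x0.
  by rewrite -[x]subr0; apply/coker_pi_eqP; rewrite x0 pi0.
- move=> _ [x _ <-]; rewrite /op_ker /= /h.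
  have -> : coker_pi Z (Z x) = f 0.
    by rewrite linear0 -pi0; apply/coker_pi_eqP; rewrite subr0; exists x.
  by rewrite fK.
- by move=> _ [x _ <-]; rewrite /= /h; case: (g _) => y /= /set_mem.
- move=> x xZ; have [y fy] := coker_pi_surj (f (SigSub (mem_set xZ))).
  by exists y => //=; rewrite /h -fy fK.
Qed.

Theorem theorem1p10 (R : realType) (X : hilbertType R) (Z : bounded_op X)
    (Z0 : generalized_index_zero Z) :
  (exists E : R -> bounded_op X, good_path Z E) /\
  (forall C : bounded_op X,
     (exists E : R -> bounded_op X, good_path Z E /\ inverse_coefN1 Z E C) <->
     (op_ker C = op_im Z /\ op_im C = op_ker Z)) /\
  (forall (E : R -> bounded_op X) (Ek : nat -> bounded_op X),
     good_path Z E ->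
     Ek 0%N = Z ->
     power_series_near0 (path_to Z E) Ek ->
     exists n : nat, (0 < n)%N /\
       (forall m : nat, (m < n)%N -> op_ker Z `<=` op_ker (Ek m)) /\
       op_ker Z `&` op_ker (Ek n) = [set 0%R]).
Proof.
split.
  have [C [kerC imC]] := index_zero_op Z0.
  by have [E [good _]] := good_path_exists kerC imC; exists E.
split=> [C|E Ek [_ [C EC]] Ek0 Ek_series].
  split=> [[E [[[_ [a /power_series_near0_cvg Ea]] _] EC]]|[]]; last first.
    exact: good_path_exists.
  have [T [ZC CZ ZT TZ]] := simple_pole_coefs Ea EC.
  split; apply/seteqP; split.
  (* The four inclusions are read off from the four identities: here [x = Z (T x) + E_1 (C x)] with
     [C x = 0]. *)
  - move=> x Cx; exists (T x) => //.
    have := congr1 (fun S : bounded_op X => S x) ZT.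
    by rewrite /= -[LHS]/(Z (T x) + a 0%N (C x)) Cx linear0 addr0.
  - by move=> _ [x _ <-]; exact: (congr1 (fun S : bounded_op X => S x) CZ).
  - by move=> _ [x _ <-]; exact: (congr1 (fun S : bounded_op X => S x) ZC).
  - move=> x Zx; exists (a 0%N x) => //.
    have := congr1 (fun S : bounded_op X => S x) TZ.
    by rewrite /= -[LHS]/(T (Z x) + C (a 0%N x)) Zx linear0 add0r.
(* Away from [t = 0], [E t] is the path minus [Z], divided by [t], so its limit is the first
   coefficient of the path. *)
have E1 : E t @[t --> 0^'+] --> Ek 1%N.
  apply: cvg_trans (power_series_near0_cvg (power_series_near0_shift Ek_series)).
  apply: near_eq_cvg; near=> t.
  have t0 : (t%:C : R[i]) != 0 by rewrite fmorph_eq0 gt_eqF.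
  by rewrite /path_to Ek0 addrAC subrr add0r scalerA mulVf// scale1r.
have [T [_ _ _ TZ]] := simple_pole_coefs E1 EC.
(* Only [m = 0] lies below 1, and [Ek 0] is [Z]. A vector killed by [Z] and [Ek 1] vanishes by
   [T Z + C E_1 = 1]. *)
exists 1%N; split=> //; split=> [[|//] _|]; first by rewrite Ek0.
apply/seteqP; split=> [x [Zx Ex]|_ ->]; last by rewrite /op_ker /= !linear0.
have := congr1 (fun S : bounded_op X => S x) TZ.
by rewrite /= -[LHS]/(T (Z x) + C (Ek 1%N x)) Zx Ex !linear0 addr0.
Unshelve. all: by end_near. Qed.
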